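(* Let $N\in\mathbb{N}$, $a_0,\dots,a_N\in\mathbb{R}$, and $D\ge 1$ (real). There exists an RNN $\mathcal{R}_a$ (with input and output dimension $1$) such that for every $t\in\mathbb{N}_0$ with $t\ge 16\log(N)$, $$\sup_{x\in[-D,D]}\left|(\mathcal{R}_a\mathcal{D}x)[t]-\sum_{i=0}^N a_i x^i\right|\le \|a\|_1\, C_1\, 4^{-C_2 t},$$ with $C_1=16N D^{2N}$ and $C_2=\frac{1}{4\lceil\log(N)\rceil}$ (for $N=1$, where $\lceil\log N\rceil=0$, we read $C_2=+\infty$ and $4^{-C_2t}=0$ for all $t\in\mathbb{N}_0$). In particular, the RNN $\mathcal{R}_a$ does not depend on $t$ or $x$.
   Context: Notation: $\mathbb{N}=\{1,2,\dots\}$, $\mathbb{N}_0=\mathbb{N}\cup\{0\}$; $\log$ is the logarithm to base $2$; $\|a\|_1=\sum_{i=0}^N|a_i|$; $(\mathbb{R}^d)^{\mathbb{N}_0}$ is the space of sequences in $\mathbb{R}^d$ indexed by $\mathbb{N}_0$; $\rho(x)=\max(0,x)$, applied componentwise to vectors. RNN: An RNN with input dimension $d\in\mathbb{N}$, output dimension $d'\in\mathbb{N}$ and hidden state size $m\in\mathbb{N}$ is given by weights $A_h\in\mathbb{R}^{m\times m}$, $A_x\in\mathbb{R}^{m\times d}$, $A_o\in\mathbb{R}^{d'\times m}$, $b_h\in\mathbb{R}^m$, $b_o\in\mathbb{R}^{d'}$. The hidden state operator $\mathcal{K}:(\mathbb{R}^d)^{\mathbb{N}_0}\to(\mathbb{R}^m)^{\mathbb{N}_0}$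 maps an input sequence $(x[t])_{t\in\mathbb{N}_0}$ to $(\mathcal{K}x)[t]=h[t]$, where $h[-1]=0$ and $h[t]=\rho(A_hh[t-1]+A_xx[t]+b_h)$ for $t\in\mathbb{N}_0$. The output mapping is $\mathcal{Q}(h)=A_oh+b_o$. The associated RNN is the operator $\mathcal{R}=\mathcal{Q}\mathcal{K}$, $(\mathcal{R}x)[t]=\mathcal{Q}((\mathcal{K}x)[t])$. The operator $\mathcal{D}:\mathbb{R}^d\to(\mathbb{R}^d)^{\mathbb{N}_0}$ is defined by $(\mathcal{D}x)[0]=x$ and $(\mathcal{D}x)[t]=0$ for $t\ge1$. *)

(* Defs.v *)
From HB Require Import structures.
From mathcomp Require Import all_boot all_order all_algebra.
From mathcomp Require Import all_classical all_reals all_analysis.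
Set Implicit Arguments.
Unset Strict Implicit.
Unset Printing Implicit Defensive.
Import Order.TTheory GRing.Theory Num.Theory.
Local Open Scope ring_scope.

(* Vectors of R^d are column vectors, sequences are indexed from 0. *)

Definition relu (R : realType) (m : nat) (v : 'cV[R]_m) : 'cV[R]_m :=
  map_mx (fun r : R => Num.max 0 r) v.

Record rnn (R : realType) (d d' m : nat) := RNN {
  A_h : 'M[R]_(m, m);
  A_x : 'M[R]_(m, d);
  A_o : 'M[R]_(d', m);
  b_h : 'cV[R]_m;
  b_o : 'cV[R]_d' }.

Definition rnn_step (R : realType) (d d' m : nat) (W : rnn R d d' m)
    (h : 'cV[R]_m) (u : 'cV[R]_d) : 'cV[R]_m :=
  relu (A_h W *m h + A_x W *m u + b_h W).

(* The base case takes the previous state h[-1] to be 0. *)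
Fixpoint hidden_state (R : realType) (d d' m : nat) (W : rnn R d d' m)
    (x : nat -> 'cV[R]_d) (t : nat) : 'cV[R]_m :=
  match t with
  | 0 => rnn_step W 0 (x 0%N)
  | t'.+1 => rnn_step W (hidden_state W x t') (x t'.+1)
  end.

Definition rnn_output (R : realType) (d d' m : nat) (W : rnn R d d' m)
    (h : 'cV[R]_m) : 'cV[R]_d' :=
  A_o W *m h + b_o W.

Definition rnn_op (R : realType) (d d' m : nat) (W : rnn R d d' m)
    (x : nat -> 'cV[R]_d) : nat -> 'cV[R]_d' :=
  fun t => rnn_output W (hidden_state W x t).

Definition impulse (R : realType) (d : nat) (x : 'cV[R]_d) : nat -> 'cV[R]_d :=
  fun t => if t == 0%N then x else 0.

Definition log2 (R : realType) (x : R) : R := ln x / ln 2.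

Definition norm1 (R : realType) (N : nat) (a : 'I_N.+1 -> R) : R :=
  \sum_(i < N.+1) `|a i|.

Definition C1 (R : realType) (N : nat) (D : R) : R :=
  16 * N%:R * D ^+ (2 * N).

(* Meaningful for N >= 2 only: for N = 1 the denominator vanishes. *)
Definition C2 (R : realType) (N : nat) : R :=
  (4 * (Num.ceil (log2 (N%:R : R)))%:~R)^-1.

(* 4^(- C2 t), where C2 is read as +oo and the power as 0, including at
   t = 0, when N = 1. *)
Definition decay (R : realType) (N t : nat) : R :=
  if N == 1%N then 0 else 4 `^ (- (C2 R N * t%:R)).

(* Main.v *)
(* Yarotsky's approximation z^2 ~ z - sum_(i <= k) 4^-i tent^i(z) on [0, 1]
   gains a factor 4 per iteration of the tent map, i.e. per time step, and
   polarization turns it into a multiplication. Layer l multiplies outputs of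
   layer l - 1, so L = ceil(log2 N) layers yield all the powers (x/D)^j,
   j <= N. As a squaring must start from an input that stays fixed, the layers
   are restarted at geometrically growing times: layer l reloads at the times
   2^k l, and its result is consumed at 2^k (l + 1), after 2^k steps, with an
   additional error 4^-(2^k). The error of layer L at 2^k (L + 1) is thus at
   most (2^L - 1) 4^-(2^k); a latch holds that value until 2^(k+1) (L + 1),
   hence for t <= 4 L 2^k, where 4^-(2^k) <= 4^-(t/(4L)). The restart pulses
   come from two integer counters, one falling at speed 1 while the other rises
   at speed 2, which exchange their roles whenever the falling one hits 0. *)

Require Import Defs.
From mathcomp Require Import all_boot all_order all_algebra.
From mathcomp Require Import all_classical all_reals all_analysis.
From mathcomp Require Import ring lra zify.
Import Order.TTheory GRing.Theory Num.Theory.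
Local Open Scope classical_set_scope.
Local Open Scope ring_scope.
Set Implicit Arguments.
Unset Strict Implicit.
Unset Printing Implicit Defensive.

(** * Networks of rectified linear units as state machines *)

(** Cells are indexed by an arbitrary finite type, so that machines can be extended by sums and
    products of index types; matrices appear only in [realizable_rnn]. *)
Record affine_form (R : realType) (V : finType) := AffineForm {
  coef_state : V -> R;
  coef_input : R;
  coef_const : R }.

Definition aval (R : realType) (V : finType) (a : affine_form R V)
    (z : V -> R) (u : R) : R :=
  \sum_v coef_state a v * z v + coef_input a * u + coef_const a.

Definition is_affine (R : realType) (V : finType) (f : (V -> R) -> R -> R) :=
  exists a : affine_form R V, forall z u, f z u = aval a z u.

(** One time step. The outer coefficients are absorbed into the affine maps of the following step,
    so that each term costs one neuron. *)
Definition is_relu_net (R : realType) (V : finType)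
    (f : (V -> R) -> R -> R) :=
  exists l : seq (R * affine_form R V),
  forall z u, f z u = \sum_(p <- l) p.1 * Num.max 0 (aval p.2 z u).

Lemma is_affine_var (R : realType) (V : finType) (v : V) :
  is_affine (fun (z : V -> R) _ => z v).
Proof.
exists (AffineForm (fun w => (w == v)%:R) 0 0) => z u.
rewrite /aval /= (bigD1 v) //= eqxx mul1r big1 ?addr0 ?mul0r ?addr0 //.
by move=> w /negPf ->; rewrite mul0r.
Qed.

Lemma is_affine_input (R : realType) (V : finType) :
  is_affine (fun (_ : V -> R) u => u).
Proof.
exists (AffineForm (fun=> 0) 1 0) => z u.
by rewrite /aval /= big1 ?add0r ?mul1r ?addr0 // => w _; rewrite mul0r.
Qed.

Lemma is_affine_const (R : realType) (V : finType) (c : R) :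
  is_affine (fun (_ : V -> R) _ => c).
Proof.
exists (AffineForm (fun=> 0) 0 c) => z u.
by rewrite /aval /= big1 ?mul0r ?add0r // => w _; rewrite mul0r.
Qed.

Lemma is_affineD (R : realType) (V : finType) (f g : (V -> R) -> R -> R) :
  is_affine f -> is_affine g -> is_affine (fun z u => f z u + g z u).
Proof.
move=> [a fE] [b gE].
exists (AffineForm (fun v => coef_state a v + coef_state b v)
  (coef_input a + coef_input b) (coef_const a + coef_const b)) => z u.
rewrite fE gE /aval /=.
under [in RHS]eq_bigr do rewrite mulrDl.
rewrite big_split /=; ring.
Qed.

Lemma is_affineZ (R : realType) (V : finType) (c : R)
    (f : (V -> R) -> R -> R) :
  is_affine f -> is_affine (fun z u => c * f z u).
Proof.
move=> [a fE].
exists (AffineForm (fun v => c * coef_state a v)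
  (c * coef_input a) (c * coef_const a)) => z u.
rewrite fE /aval /= !mulrDr mulr_sumr !mulrA.
by congr (_ + _ + _); apply: eq_bigr => v _; rewrite mulrA.
Qed.

Lemma is_affineN (R : realType) (V : finType) (f : (V -> R) -> R -> R) :
  is_affine f -> is_affine (fun z u => - f z u).
Proof.
move=> /(is_affineZ (-1)) [a aE]; exists a => z u.
by rewrite -aE mulN1r.
Qed.

Lemma is_affine_sum (R : realType) (V : finType) (K : Type) (r : seq K)
    (f : K -> (V -> R) -> R -> R) :
  (forall k, is_affine (f k)) -> is_affine (fun z u => \sum_(k <- r) f k z u).
Proof.
move=> hf; elim: r => [|k r [b bE]].
  have [a aE] := is_affine_const V (0 : R).
  by exists a => z u; rewrite big_nil -aE.
have [a aE] : is_affine (fun z u => f k z u + aval b z u).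
  by apply: is_affineD => //; exists b.
by exists a => z u; rewrite big_cons bE aE.
Qed.

Lemma is_affine_comp (R : realType) (V W : finType)
    (f : (W -> R) -> R -> R) (g : W -> (V -> R) -> R -> R) :
  is_affine f -> (forall w, is_affine (g w)) ->
  is_affine (fun z u => f (fun w => g w z u) u).
Proof.
move=> [a aE] hg.
have [b bE] : is_affine (fun z u =>
    \sum_w coef_state a w * g w z u + coef_input a * u + coef_const a).
  apply: is_affineD; last exact: is_affine_const.
  apply: is_affineD; last by apply: is_affineZ; exact: is_affine_input.
  by apply: is_affine_sum => w; apply: is_affineZ.
by exists b => z u; rewrite aE -bE.
Qed.

Lemma is_affine_input0 (R : realType) (V : finType)
    (f : (V -> R) -> R -> R) :
  is_affine f -> is_affine (fun z _ => f z 0).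
Proof.
move=> [a aE]; exists (AffineForm (coef_state a) 0 (coef_const a)) => z u.
by rewrite aE /aval /= mulr0 mul0r.
Qed.

Lemma is_relu_netD (R : realType) (V : finType) (f g : (V -> R) -> R -> R) :
  is_relu_net f -> is_relu_net g -> is_relu_net (fun z u => f z u + g z u).
Proof.
by move=> [l lE] [k kE]; exists (l ++ k) => z u; rewrite big_cat /= lE kE.
Qed.

Lemma is_relu_netZ (R : realType) (V : finType) (c : R)
    (f : (V -> R) -> R -> R) :
  is_relu_net f -> is_relu_net (fun z u => c * f z u).
Proof.
move=> [l lE]; exists [seq (c * p.1, p.2) | p <- l] => z u.
rewrite lE mulr_sumr big_map /=.
by apply: eq_bigr => p _; rewrite mulrA.
Qed.

Lemma is_relu_netN (R : realType) (V : finType) (f : (V -> R) -> R -> R) :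
  is_relu_net f -> is_relu_net (fun z u => - f z u).
Proof.
move=> /(is_relu_netZ (-1)) [a aE]; exists a => z u.
by rewrite -aE mulN1r.
Qed.

Lemma is_relu_netB (R : realType) (V : finType) (f g : (V -> R) -> R -> R) :
  is_relu_net f -> is_relu_net g -> is_relu_net (fun z u => f z u - g z u).
Proof. by move=> hf hg; apply: is_relu_netD => //; apply: is_relu_netN. Qed.

Lemma is_relu_net_relu (R : realType) (V : finType)
    (f : (V -> R) -> R -> R) :
  is_affine f -> is_relu_net (fun z u => Num.max 0 (f z u)).
Proof.
by move=> [a aE]; exists [:: (1, a)] => z u; rewrite big_seq1 mul1r aE.
Qed.

Lemma relu_subN (R : realType) (x : R) : Num.max 0 x - Num.max 0 (- x) = x.
Proof. by case: (leP 0 x) => h; case: (leP 0 (- x)) => h'; lra. Qed.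

(** A signed value survives the rectifier as the difference of its positive and negative parts. *)
Lemma is_relu_net_affine (R : realType) (V : finType)
    (f : (V -> R) -> R -> R) :
  is_affine f -> is_relu_net f.
Proof.
move=> hf.
have [l lE] : is_relu_net (fun z u =>
    Num.max 0 (f z u) - Num.max 0 (- f z u)).
  apply: is_relu_netB; apply: is_relu_net_relu => //; exact: is_affineN.
by exists l => z u; rewrite -lE relu_subN.
Qed.

(** The substituted maps are affine because a rectifier inside another one would take a second time
    step. *)
Lemma is_relu_net_comp (R : realType) (V W : finType)
    (f : (W -> R) -> R -> R) (g : W -> (V -> R) -> R -> R) :
  is_relu_net f -> (forall w, is_affine (g w)) ->
  is_relu_net (fun z u => f (fun w => g w z u) u).
Proof.
move=> [l lE] hg.
suff [k kE] : is_relu_net (fun z u =>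
    \sum_(p <- l) p.1 * Num.max 0 (aval p.2 (fun w => g w z u) u)).
  by exists k => z u; rewrite lE kE.
elim: {f lE} l => [|p l [k kE]].
  by exists [::] => z u; rewrite !big_nil.
have [k' k'E] : is_relu_net (fun z u =>
    p.1 * Num.max 0 (aval p.2 (fun w => g w z u) u)).
  apply/is_relu_netZ/is_relu_net_relu.
  by apply: (@is_affine_comp _ _ _ (aval p.2)) => //; exists p.2.
exists (k' ++ k) => z u.
by rewrite big_cons big_cat /= kE k'E.
Qed.

(** * Realizable families of sequences *)

Definition impulse_at (R : realType) (x : R) (n : nat) : R :=
  if n == 0%N then x else 0.

(* The state at time [n] has absorbed the inputs of times [0, ..., n - 1], so
   an RNN at time [t] is in state [t + 1]. *)
Definition realizable (R : realType) (I : Type) (y : I -> R -> nat -> R) :=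
  exists (V : finType) (e : V -> R) (F : V -> (V -> R) -> R -> R)
    (s : R -> nat -> V -> R),
  [/\ forall v, is_relu_net (F v),
      forall x v, s x 0%N v = e v,
      forall x n v, s x n.+1 v = F v (s x n) (impulse_at x n) &
      forall i, exists2 g : (V -> R) -> R -> R, is_affine g &
        forall x n u, y i x n = g (s x n) u].

Lemma realizable_affine (R : realType) (I J : Type) (y : I -> R -> nat -> R)
    (y' : J -> R -> nat -> R) (K : finType) (k : K -> I)
    (g : J -> (K -> R) -> R -> R) :
  realizable y -> (forall j, is_affine (g j)) ->
  (forall j x n, y' j x n = g j (fun i => y (k i) x n) 0) -> realizable y'.
Proof.
move=> [V [e [F [s [hF s0 sS ys]]]]] hg y'E.
exists V, e, F, s; split=> // j.
have [h hP] := choice (fun i => let: ex_intro2 g0 p q := ys (k i) in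
  ex_intro (fun g1 => is_affine g1 /\ forall x n u, y (k i) x n = g1 (s x n) u)
    g0 (conj p q)).
exists (fun z _ => g j (fun i => h i z 0) 0).
  apply: (@is_affine_input0 _ _ (fun z u => g j (fun i => h i z u) u)).
  by apply: is_affine_comp => // i; case: (hP i).
move=> x n u; rewrite y'E; congr (g j _ 0).
by apply/funext => i; have [_ hE] := hP i; rewrite (hE x n 0).
Qed.

Definition sum_fam (R : realType) (I J : Type) (y : I -> R -> nat -> R)
    (s : J -> R -> nat -> R) (k : I + J) : R -> nat -> R :=
  match k with inl i => y i | inr j => s j end.

(** New cells [J] may read the outputs [y] without delay: these are affine in the old cells, so they
    can be substituted under the rectifiers of [G]. *)
Lemma realizable_ext (R : realType) (I J : finType) (y : I -> R -> nat -> R)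
    (s : J -> R -> nat -> R) (e : J -> R)
    (G : J -> (I + J -> R) -> R -> R) :
  realizable y -> (forall j, is_relu_net (G j)) ->
  (forall j x, s j x 0%N = e j) ->
  (forall j x n, s j x n.+1
    = G j (fun k => sum_fam y s k x n) (impulse_at x n)) ->
  realizable (sum_fam y s).
Proof.
move=> [V [e' [F [s' [hF s'0 s'S ys]]]]] hG s0 sS.
have [h hP] := choice (fun i => let: ex_intro2 g0 p q := ys i in
  ex_intro (fun g1 => is_affine g1 /\ forall x n u, y i x n = g1 (s' x n) u)
    g0 (conj p q)).
(* The readouts are evaluated at input 0, which is legitimate because they give [y i] for every
   [u]. *)
pose g (k : I + J) : (V + J -> R) -> R -> R :=
  match k with
  | inl i => fun z _ => h i (fun v => z (inl v)) 0
  | inr j => fun z _ => z (inr j)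
  end.
have g_aff k : is_affine (g k).
  case: k => [i|j]; last exact: is_affine_var.
  have [[a aE] _] := hP i.
  exists (AffineForm (fun v => if v is inl v then coef_state a v else 0) 0
    (coef_const a)) => z u.
  rewrite /= aE /aval /= mulr0 mul0r; congr (_ + _ + _).
  rewrite big_sumType /= [X in _ = _ + X]big1 ?addr0 //.
  by move=> j _; rewrite mul0r.
pose S x n (v : V + J) := match v with inl v => s' x n v | inr j => s j x n end.
have gS k x n u : sum_fam y s k x n = g k (S x n) u.
  by case: k => [i|j] //=; case: (hP i) => _; apply.
exists (V + J)%type, (fun v => match v with inl v => e' v | inr j => e j end),
  (fun v => match v with
    | inl v => fun z u => F v (fun w => z (inl w)) u
    | inr j => fun z u => G j (fun k => g k z u) u end), S.
split.
- case=> [v|j].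
    apply: (@is_relu_net_comp _ _ _ (F v)) => // w; exact: is_affine_var.
  exact: is_relu_net_comp.
- by move=> x [v|j] /=.
- move=> x n [v|j] /=; first exact: s'S.
  rewrite sS; congr (G j _ _); apply/funext => k; exact: gS.
- by move=> k; exists (g k) => // x n u; exact: gS.
Qed.

(** The neurons are the rectified terms of all the [F v]. The machine state is an affine function of
    their values, so composing it with the affine forms of the next step yields the recurrent
    weights. *)
Lemma realizable_rnn (R : realType) (I : Type) (y : I -> R -> nat -> R)
    (i : I) :
  realizable y -> exists m : nat, (0 < m)%N /\
  exists W : rnn R 1 1 m, forall x t,
    rnn_op W (impulse (const_mx x)) t ord0 ord0 = y i x t.+1.
Proof.
move=> [V [e [F [s [hF s0 sS ys]]]]].
have [g [a aE] yE] := ys i.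
(* An RNN starts from the zero state, so the output bias has to encode [e]. *)
have hFe v : is_relu_net (fun z u => F v z u - e v).
  apply: is_relu_netB => //; apply/is_relu_net_affine/is_affine_const.
have [l lE] := choice hFe.
pose T := {v : V & 'I_(size (l v))}.
pose nrn (q : T) : R * affine_form R V :=
  tnth (in_tuple (l (tag q))) (tagged q).
(* The extra neuron always holds 0; it makes the hidden size positive. *)
pose T1 := (T + unit)%type.
have T1_gt0 : (0 < #|{: T1}|)%N by apply/card_gt0P; exists (inr tt).
pose oe (A : Type) (d : A) (f : T -> A) (q : T1) :=
  if q is inl q then f q else d.
pose ev := @enum_val T1 predT.
pose W : rnn R 1 1 #|{: T1}| := RNN
  (\matrix_(p, q) oe _ 0 (fun p => oe _ 0 (fun q =>
     coef_state (nrn p).2 (tag q) * (nrn q).1) (ev q)) (ev p))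
  (\matrix_(p, _) oe _ 0 (fun p => coef_input (nrn p).2) (ev p))
  (\matrix_(_, q) oe _ 0 (fun q => coef_state a (tag q) * (nrn q).1) (ev q))
  (\col_p oe _ 0 (fun p => coef_const (nrn p).2
     + \sum_v coef_state (nrn p).2 v * e v) (ev p))
  (const_mx (coef_const a + \sum_v coef_state a v * e v)).
exists #|{: T1}|; split => //; exists W => x t.
(* [st h] is the machine state encoded by the hidden state [h]. *)
pose st (h : T1 -> R) v := e v + \sum_(j < size (l v))
  (nrn (Tagged (fun v => 'I_(size (l v))) j)).1
   * h (inl (Tagged (fun v => 'I_(size (l v))) j)).
(* A weight row applied to the neurons, plus its share of the bias, equals the linear form [c] on
   the decoded state. *)
have sumT (c : V -> R) (h : T1 -> R) (h0 : 'cV[R]_#|{: T1}|) :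
    (forall q, h0 q ord0 = h (ev q)) ->
    \sum_q oe _ 0 (fun q => c (tag q) * (nrn q).1) (ev q) * h0 q ord0
    + \sum_v c v * e v = \sum_v c v * st h v.
  move=> hE.
  have -> : \sum_q oe _ 0 (fun q => c (tag q) * (nrn q).1) (ev q) * h0 q ord0
     = \sum_(q : T1) oe _ 0 (fun q => c (tag q) * (nrn q).1) q * h q.
    rewrite [RHS](reindex ev) /=; last first.
      by apply: onW_bij; apply: enum_val_bij.
    by apply: eq_bigr => q _; rewrite hE.
  rewrite big_sumType /= (eq_bigr (fun=> 0) (fun _ _ => mul0r _)) big1_eq addr0.
  pose Fn v (j : 'I_(size (l v))) : R := c v
    * (nrn (Tagged (fun v => 'I_(size (l v))) j)).1
    * h (inl (Tagged (fun v => 'I_(size (l v))) j)).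
  transitivity (\sum_v \sum_j Fn v j + \sum_v c v * e v).
    congr (_ + _); rewrite (sig_big_dep xpredT (fun=> xpredT) Fn) /=.
    by apply: eq_bigr => -[].
  rewrite -big_split /=; apply: eq_bigr => v _.
  rewrite /st mulrDr addrC; congr (_ + _).
  by rewrite mulr_sumr; apply: eq_bigr => j _; rewrite /Fn mulrA.
(* The zero vector before time 0 decodes to [e], hence [hid 0] is 0 and the hidden state at time n
   is [hid n.+1]. *)
pose hid n q := if n is n'.+1 then
  oe _ 0 (fun p => Num.max 0 (aval (nrn p).2 (s x n') (impulse_at x n'))) q
  else 0.
have stE n : st (hid n) = s x n.
  apply/funext => v; case: n => [|n].
    by rewrite /st s0 /= big1 ?addr0 // => j _; rewrite mulr0.
  rewrite /st sS -[F v _ _](subrK (e v)) lE addrC; congr (_ + _).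
  by rewrite [RHS]big_tnth; apply: eq_bigr => j _.
have stepE n (h0 : 'cV[R]_#|{: T1}|) (h : 'cV[R]_1) :
    (forall q, h0 q ord0 = hid n (ev q)) ->
    h ord0 ord0 = impulse_at x n ->
    forall q, rnn_step W h0 h q ord0 = hid n.+1 (ev q).
  move=> h0E hE q; rewrite /rnn_step /relu !mxE /= big_ord1 !mxE hE.
  under eq_bigr do rewrite mxE.
  case: (ev q) => [p|[]] /=; last first.
    rewrite mul0r !addr0 big1 ?maxxx // => j _.
    by rewrite mul0r.
  congr (Num.max 0 _); rewrite /aval -stE.
  rewrite -(sumT (coef_state (nrn p).2) (hid n) h0) //.
  ring.
have hidE n q : hidden_state W (impulse (const_mx x)) n q ord0
    = hid n.+1 (ev q).
  elim: n q => [|n IH] q; first by apply: stepE => [q'|]; rewrite !mxE.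
  by apply: stepE => //; rewrite /= !mxE.
rewrite /rnn_op /rnn_output !mxE (yE x t.+1 0) aE /aval mulr0 addr0 -stE.
rewrite -(sumT (coef_state a) (hid t.+1) _ (hidE t)).
under eq_bigr do rewrite mxE.
by rewrite (addrC (coef_const a)) addrA.
Qed.

(** * Clocks *)

(* The state is (u, v, m, r): counters u and v, the mode m (u falls if m = 0,
   v falls if m = 1) and the pulse r. The term (2 + A)(1 - m) disables the test
   on v in mode 0, where v can be as low as its initial value - A. *)
Definition clock_step (R : realType) (A : nat) (c : R * R * R * R) :=
  let: (u, v, m, _) := c in
  let hu := Num.max 0 (2 - u - 2 * m) in
  let hv := Num.max 0 (2 - v - (2 + A%:R) * (1 - m)) in
  (u - 1 + 3 * m, v + 2 - 3 * m, m + hu - hv, hu + hv).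

(** Starting v at - A makes it equal to A when u first reaches 0, at time A. The next phase then
    lasts A steps, and every later one is twice as long as its predecessor. *)
Definition clock (R : realType) (A n : nat) : R * R * R * R :=
  iter n (@clock_step R A) (A%:R, - A%:R, 0, 0).

Lemma clockS (R : realType) (A n : nat) :
  clock R A n.+1 = clock_step A (clock R A n).
Proof. by []. Qed.

Definition pulse (R : realType) (A n : nat) : R := (clock R A n).2.

Definition pulse_time (A n : nat) : bool := `[< exists k, n = 2 ^ k * A >]%N.

(* The state at time n during the phase that ends at time 2^j A. *)
Definition clock_at (R : realType) (A j n : nat) (r : R) : R * R * R * R :=
  let f := (2 ^ j * A)%:R - n%:R in
  let g := 2 * n%:R - (2 ^ j * A)%:R in
  if odd j then (g, f, 1, r) else (f, g, 0, r).

(** For j > 0 the phase starts at half its end time, so the rising counter is nonnegative; in phase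
    0 it is only at least - A. When the phase ends the rising counter equals 2^j A, the length of
    the next phase. *)
Lemma clock_step_at (R : realType) (A j n : nat) (r : R) :
  (n < 2 ^ j * A)%N -> (j == 0%N) || (2 ^ j * A <= 2 * n)%N ->
  clock_step A (clock_at A j n r) =
  if n.+1 == (2 ^ j * A)%N then clock_at A j.+1 n.+1 1
  else clock_at A j n.+1 0.
Proof.
move=> lt_n ge_n.
have [p pE] : exists p, p = (2 ^ j * A)%N by exists (2 ^ j * A)%N.
have p2E : (2 ^ j.+1 * A = p + p)%N by rewrite expnS pE; lia.
rewrite /clock_at oddS p2E -pE; rewrite -pE in lt_n ge_n.
have := lt_n; rewrite -(ler_nat R) -natr1 => ltR.
have gt_pA : (A <= p)%N by rewrite pE leq_pmull // expn_gt0.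
have geA : - A%:R <= 2 * n%:R - p%:R :> R.
  case/orP: ge_n => [/eqP j0|le_p].
    have -> : p = A by rewrite pE j0 mul1n.
    have := ler0n R n; lra.
  have := ler0n R A; move: le_p; rewrite -(ler_nat R) natrM; lra.
have ge0 : odd j -> 0 <= 2 * n%:R - p%:R :> R.
  case: j ge_n {pE p2E} => [//|j] /= le_p _.
  by move: le_p; rewrite -(ler_nat R) natrM; lra.
(* The falling counter is an integer at least 1, so the rectifier detects the value 1, one step
   before the counter hits 0. *)
have cut : Num.max 0 (2 - (p%:R - n%:R)) = (n.+1 == p)%:R :> R.
  case: eqP => [<-|ne_p]; first by rewrite -[n.+1%:R]natr1 max_r /=; lra.
  have: (n.+2 <= p)%N by lia.
  by rewrite -(ler_nat R) -addn2 natrD => h; rewrite max_l /=; lra.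
rewrite natrD.
case: (boolP (odd j)) => [/ge0 {}ge0|_] /=.
  rewrite (_ : 2 - _ - (2 + A%:R) * (1 - 1) = 2 - (p%:R - n%:R)); last by ring.
  rewrite cut max_l; last lra.
  case: eqP => [<-|_] /=; rewrite -?[n.+1%:R]natr1 /=; congr (_, _, _, _); ring.
rewrite (_ : 2 - _ - 2 * 0 = 2 - (p%:R - n%:R)); last by ring.
rewrite cut [Num.max 0 _]max_l; last lra.
case: eqP => [<-|_] /=; rewrite -?[n.+1%:R]natr1 /=; congr (_, _, _, _); ring.
Qed.

(** Here j is the phase containing n, and the pulse marks the first instant of each phase j > 0. *)
Lemma clockP (R : realType) (A n : nat) : (0 < A)%N -> exists j,
  [/\ (n < 2 ^ j * A)%N, (j == 0%N) || (2 ^ j * A <= 2 * n)%N &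
      clock R A n = clock_at A j n ((0 < j) && (2 ^ j * A == 2 * n))%N%:R].
Proof.
move=> A_gt0; elim: n => [|n [j [lt_n ge_n cE]]].
  exists 0%N; rewrite mul1n; split=> //.
  by rewrite /clock /clock_at /= mul1n subr0 mulr0 sub0r.
rewrite clockS cE clock_step_at //.
case: eqP => [nE|ne_n]; [exists j.+1|exists j].
  have -> : (2 ^ j.+1 * A = 2 * n.+1)%N by rewrite nE expnS; lia.
  by split; rewrite ?eqxx //; lia.
have -> : ((0 < j) && (2 ^ j * A == 2 * n.+1) = false)%N.
  by apply/negbTE/negP; move: ge_n; case: eqP => [->|]; lia.
by split => //; lia.
Qed.

Lemma pulseE (R : realType) (A n : nat) : (0 < A)%N ->
  pulse R A n = (pulse_time A n)%:R.
Proof.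
move=> A_gt0; have [j [lt_n ge_n cE]] := clockP R n A_gt0.
rewrite /pulse cE /clock_at (fun_if snd) /= if_same; congr (nat_of_bool _)%:R.
apply/idP/asboolP => [|[k nE]].
  case: j {lt_n ge_n cE} => [//|j] /= /eqP nE.
  by exists j; move: nE; rewrite expnS; lia.
move: lt_n ge_n; rewrite nE mulnA -expnS !leq_pmul2r // ltn_pmul2r //.
rewrite ltn_exp2l // leq_exp2l // => lt_kj.
by case/orP => [/eqP j0|le_jk]; [lia|rewrite (_ : j = k.+1) ?eqxx //; lia].
Qed.

Lemma pulse_time_exp (A k : nat) : pulse_time A (2 ^ k * A).
Proof. by apply/asboolP; exists k. Qed.

Lemma pulse_time_between (A k n : nat) :
  (2 ^ k * A < n)%N -> (n < 2 ^ k.+1 * A)%N -> ~~ pulse_time A n.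
Proof.
move=> lt_n gt_n; apply/negP => /asboolP[j nE].
have A_gt0 : (0 < A)%N by case: A {nE} lt_n gt_n; lia.
move: lt_n gt_n; rewrite nE !ltn_pmul2r // !ltn_exp2l //; lia.
Qed.

Lemma pulse_time_before (A n : nat) : (n < A)%N -> ~~ pulse_time A n.
Proof.
move=> lt_n; apply/negP => /asboolP[j nE]; move: lt_n.
by rewrite nE ltnNge leq_pmull ?expn_gt0.
Qed.

(** * Squaring, multiplication and latching *)

(** This is min (2 y) (2 - 2 y), written with a single rectifier. *)
Definition tent (R : realType) (y : R) : R := 2 * (y - Num.max 0 (2 * y - 1)).

Fixpoint sq_approx (R : realType) (k : nat) (z : R) : R :=
  if k is k'.+1 then sq_approx k' z - 4^-1 ^+ k * iter k (@tent R) z else z.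

Lemma tent_itv (R : realType) (y : R) : 0 <= y <= 1 -> 0 <= tent y <= 1.
Proof. by rewrite /tent; case: (leP 0 (2 * y - 1)) => h; lra. Qed.

Lemma iter_tent_itv (R : realType) (k : nat) (z : R) : 0 <= z <= 1 ->
  0 <= iter k (@tent R) z <= 1.
Proof. by move=> z01; elim: k => //= k IH; apply: tent_itv. Qed.

(** Self-similarity of the parabola: y - y^2 is a quarter of tent y plus a quarter of the same
    parabola at tent y. This is the source of the factor 4 per iteration. *)
Lemma tent_quadratic (R : realType) (y : R) :
  4 * (y - y ^+ 2) = tent y + (tent y - tent y ^+ 2).
Proof. by rewrite /tent; case: (leP 0 (2 * y - 1)) => h; ring. Qed.

Lemma sq_approxE (R : realType) (k : nat) (z : R) :
  let y := iter k (@tent R) z in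
  sq_approx k z - z ^+ 2 = 4^-1 ^+ k * (y - y ^+ 2).
Proof.
elim: k => [|k IH] /=; first by rewrite expr0 mul1r.
rewrite addrAC IH /= !(exprSr 4^-1 k).
have := tent_quadratic (iter k (@tent R) z).
move: (iter k (@tent R) z) => y hy.
have -> : y - y ^+ 2 = 4^-1 * (tent y + (tent y - tent y ^+ 2)).
  by rewrite -hy; field.
ring.
Qed.

Lemma sq_approx_err (R : realType) (k : nat) (z : R) : 0 <= z <= 1 ->
  0 <= sq_approx k z - z ^+ 2 <= 4^-1 ^+ k.+1.
Proof.
move=> z01; rewrite sq_approxE /=.
have := iter_tent_itv k z01; move: (iter k (@tent R) z) => y y01.
have q0 : 0 <= 4^-1 ^+ k :> R by apply: exprn_ge0; lra.
rewrite (exprSr 4^-1 k) mulr_ge0 //=; last nra.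
(* The bound y - y^2 <= 1/4 supplies the last factor of the exponent [k.+1]. *)
by rewrite ler_wpM2l //; have := sqr_ge0 (y - 2^-1); nra.
Qed.

Lemma sq_approx_itv (R : realType) (k : nat) (z : R) : 0 <= z <= 1 ->
  0 <= sq_approx k z <= 1.
Proof.
move=> z01; apply/andP; split.
  have /andP[+ _] := sq_approx_err k z01; have := sqr_ge0 z; lra.
suff: sq_approx k z <= z by lra.
elim: k => //= k IH; apply: le_trans IH; rewrite lerBlDr lerDl.
apply: mulr_ge0; first by apply: exprn_ge0; lra.
by have /andP[] := tent_itv (iter_tent_itv k z01).
Qed.

(* The state is (4^-k tent^k(z), 4^-k, sq_approx k z); a pulse r = 1 reloads it
   with k = 0 and z = |w|. *)
Definition squarer_step (R : realType) (r w : R) (c : R * R * R) :=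
  let: (s, M, q) := c in
  let h := 2^-1 * (Num.max 0 (s - r) - Num.max 0 (2 * s - M - 2 * r)) in
  let load := Num.max 0 (w + r - 1) + Num.max 0 (- w + r - 1) in
  (h + load, Num.max 0 (4^-1 * M - r) + r, Num.max 0 (q - r) - h + load).

(** The start is [sq_state 0 0], so the state has the form [sq_state k z] even before the first
    pulse. *)
Fixpoint squarer (R : realType) (r w : nat -> R) (n : nat) : R * R * R :=
  if n is n'.+1 then squarer_step (r n') (w n') (squarer r w n')
  else (0, 1, 0).

Lemma squarerS (R : realType) (r w : nat -> R) (n : nat) :
  squarer r w n.+1 = squarer_step (r n) (w n) (squarer r w n).
Proof. by []. Qed.

Definition sq_state (R : realType) (k : nat) (z : R) : R * R * R :=
  (4^-1 ^+ k * iter k (@tent R) z, 4^-1 ^+ k, sq_approx k z).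

(** The old components lie in [0, 1], so subtracting the pulse under the rectifiers erases them,
    while the two parts of w add up to its absolute value. *)
Lemma squarer_load (R : realType) (w z : R) (k : nat) :
  `|w| <= 1 -> 0 <= z <= 1 ->
  squarer_step 1 w (sq_state k z) = sq_state 0 `|w|.
Proof.
move=> w1 z01; rewrite /squarer_step /sq_state /= !expr0 !mul1r.
have /andP[g0 g1] := iter_tent_itv k z01.
have /andP[a0 a1] := sq_approx_itv k z01.
have q0 : 0 <= 4^-1 ^+ k :> R by apply: exprn_ge0; lra.
have q1 : 4^-1 ^+ k <= 1 :> R by apply: exprn_ile1; lra.
have s0 : 4^-1 ^+ k * iter k (@tent R) z <= 1 by apply: mulr_ile1.
move: (4^-1 ^+ k * _) s0 => s s0.
rewrite (@max_l _ _ 0 (s - 1)); last lra.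
rewrite (@max_l _ _ 0 (2 * s - _ - _)); last lra.
rewrite (@max_l _ _ 0 (4^-1 * _ - _)); last lra.
rewrite (@max_l _ _ 0 (sq_approx k z - 1)); last lra.
have -> : Num.max 0 (w + 1 - 1) + Num.max 0 (- w + 1 - 1) = `|w|.
  rewrite !addrK; case: (leP 0 w) => h; case: (leP 0 (- w)) => h' //.
  - have -> : w = 0 by lra.
    by rewrite normr0; lra.
  - by rewrite ger0_norm //; lra.
  - by rewrite ler0_norm; lra.
  - by lra.
by congr (_, _, _); ring.
Qed.

(** Keeping tent^k(z) multiplied by 4^-k avoids a product of cells, since the rectifier is
    positively homogeneous. Without a pulse, |w| <= 1 keeps the load at 0. *)
Lemma squarer_iter (R : realType) (w z : R) (k : nat) :
  `|w| <= 1 -> 0 <= z <= 1 ->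
  squarer_step 0 w (sq_state k z) = sq_state k.+1 z.
Proof.
move=> /ler_normlP[w1 w2] z01; rewrite /squarer_step /sq_state.
have /andP[g0 g1] := iter_tent_itv k z01.
have /andP[a0 a1] := sq_approx_itv k z01.
have q0 : 0 <= 4^-1 ^+ k :> R by apply: exprn_ge0; lra.
rewrite !subr0 !mulr0 !subr0 !addr0.
rewrite (@max_l _ _ 0 (w - 1)); last lra.
rewrite (@max_l _ _ 0 (- w - 1)); last lra.
rewrite (@max_r _ _ 0 (sq_approx k z)) //.
rewrite (@max_r _ _ 0 (4^-1 * _)); last by apply: mulr_ge0 => //; lra.
rewrite (@max_r _ _ 0 (4^-1 ^+ k * _)); last exact: mulr_ge0.
have -> : Num.max 0 (2 * (4^-1 ^+ k * iter k (@tent R) z) - 4^-1 ^+ k)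
    = 4^-1 ^+ k * Num.max 0 (2 * iter k (@tent R) z - 1).
  by rewrite maxr_pMr // mulr0; congr (Num.max _ _); ring.
rewrite /= exprS /tent; move: (iter k _ z) (Num.max _ _) => y m.
by congr (_, _, _); field.
Qed.

Lemma squarerP (R : realType) (r w : nat -> R) (b : nat -> bool) (n : nat) :
  (forall n, r n = (b n)%:R) -> (forall n, `|w n| <= 1) ->
  exists k z, 0 <= z <= 1 /\ squarer r w n = sq_state k z.
Proof.
move=> rE w1; elim: n => [|n [k [z [z01 sE]]]].
  exists 0%N, 0; split; first lra.
  by rewrite /sq_state /= mulr0 expr0.
rewrite /= rE sE; case: (b n).
  exists 0%N, `|w n|; split; last exact: squarer_load.
  by rewrite normr_ge0 w1.
by exists k.+1, z; split => //; apply: squarer_iter.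
Qed.

Lemma squarer_run (R : realType) (r w : nat -> R) (b : nat -> bool)
    (n k : nat) :
  (forall n, r n = (b n)%:R) -> (forall n, `|w n| <= 1) ->
  b n -> (forall i, (i < k)%N -> ~~ b (n.+1 + i)%N) ->
  squarer r w (n.+1 + k) = sq_state k `|w n|.
Proof.
move=> rE w1 bn; elim: k => [_|k IH bk].
  rewrite addn0 /= rE bn.
  have [k [z [z01 ->]]] := squarerP n rE w1; exact: squarer_load.
rewrite addnS squarerS IH => [|i lt_ik]; last by apply: bk; lia.
rewrite rE (negbTE (bk k _)) //; apply: squarer_iter => //.
by rewrite normr_ge0 w1.
Qed.

(** The product is the difference of the squares of (a + b) / 2 and (a - b) / 2. Both squaring
    errors lie in [0, 4^-(k+1)], so their difference costs no factor 2. *)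
Lemma polarization_err (R : realType) (k : nat) (a b : R) :
  `|a| <= 1 -> `|b| <= 1 ->
  `|sq_approx k `|2^-1 * (a + b)| - sq_approx k `|2^-1 * (a - b)| - a * b|
  <= 4^-1 ^+ k.+1.
Proof.
move=> /ler_normlP[a1 a2] /ler_normlP[b1 b2].
have e1 : 0 <= `|2^-1 * (a + b)| <= 1.
  by rewrite normr_ge0 ler_norml; apply/andP; split; lra.
have e2 : 0 <= `|2^-1 * (a - b)| <= 1.
  by rewrite normr_ge0 ler_norml; apply/andP; split; lra.
have := sq_approx_err k e1; have := sq_approx_err k e2.
rewrite !real_normK ?num_real //.
have -> : a * b = (2^-1 * (a + b)) ^+ 2 - (2^-1 * (a - b)) ^+ 2 by field.
by move=> h1 h2; rewrite ler_norml; apply/andP; split; lra.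
Qed.

Definition multiplier (R : realType) (r a b : nat -> R) (n : nat) : R :=
  (squarer r (fun m => 2^-1 * (a m + b m)) n).2
  - (squarer r (fun m => 2^-1 * (a m - b m)) n).2.

Lemma half_sum_bound (R : realType) (a b : R) : `|a| <= 1 -> `|b| <= 1 ->
  `|2^-1 * (a + b)| <= 1 /\ `|2^-1 * (a - b)| <= 1.
Proof.
move=> /ler_normlP[a1 a2] /ler_normlP[b1 b2].
by split; rewrite ler_norml; apply/andP; split; lra.
Qed.

Lemma multiplier_bound (R : realType) (r a b : nat -> R) (p : nat -> bool)
    (n : nat) : (forall n, r n = (p n)%:R) ->
  (forall n, `|a n| <= 1) -> (forall n, `|b n| <= 1) ->
  `|multiplier r a b n| <= 1.
Proof.
move=> rE a1 b1; rewrite /multiplier.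
have [k [z [z01 ->]]] := squarerP n rE
  (fun m => (half_sum_bound (a1 m) (b1 m)).1).
have [k' [z' [z'01 ->]]] := squarerP n rE
  (fun m => (half_sum_bound (a1 m) (b1 m)).2).
have := sq_approx_itv k z01; have := sq_approx_itv k' z'01.
by move=> h h'; rewrite ler_norml /=; apply/andP; split; lra.
Qed.

(** The operands are sampled at the pulse only and may change afterwards; this lets a layer restart
    while the next one computes. *)
Lemma multiplier_run (R : realType) (r a b : nat -> R) (p : nat -> bool)
    (n k : nat) : (forall n, r n = (p n)%:R) ->
  (forall n, `|a n| <= 1) -> (forall n, `|b n| <= 1) ->
  p n -> (forall i, (i < k)%N -> ~~ p (n.+1 + i)%N) ->
  `|multiplier r a b (n.+1 + k) - a n * b n| <= 4^-1 ^+ k.+1.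
Proof.
move=> rE a1 b1 pn pk; rewrite /multiplier.
rewrite (squarer_run rE (fun m => (half_sum_bound (a1 m) (b1 m)).1) pn pk).
rewrite (squarer_run rE (fun m => (half_sum_bound (a1 m) (b1 m)).2) pn pk).
exact: polarization_err.
Qed.

(** A switch between z and p: an offset B under both rectifiers of a signed value closes its path,
    provided that B bounds the value. *)
Definition latch_step (R : realType) (B r p z : R) : R :=
  Num.max 0 (z - B * r) - Num.max 0 (- z - B * r)
  + (Num.max 0 (p + B * r - B) - Num.max 0 (- p + B * r - B)).

Fixpoint latch (R : realType) (B : R) (r p : nat -> R) (n : nat) : R :=
  if n is n'.+1 then latch_step B (r n') (p n') (latch B r p n') else 0.

Lemma latchS (R : realType) (B : R) (r p : nat -> R) (n : nat) :
  latch B r p n.+1 = latch_step B (r n) (p n) (latch B r p n).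
Proof. by []. Qed.

Lemma latch_stepE (R : realType) (B p z : R) (b : bool) :
  `|p| <= B -> `|z| <= B -> latch_step B b%:R p z = if b then p else z.
Proof.
move=> /ler_normlP[p1 p2] /ler_normlP[z1 z2]; rewrite /latch_step.
case: b; rewrite /= ?mulr1 ?mulr0 ?addrK ?subr0 ?addr0 relu_subN.
  by rewrite !max_l; lra.
by rewrite [X in _ + (X - _)]max_l ?[X in _ + (_ - X)]max_l; lra.
Qed.

Lemma latch_bound (R : realType) (B : R) (r p : nat -> R) (b : nat -> bool)
    (n : nat) : 0 <= B ->
  (forall n, r n = (b n)%:R) -> (forall n, `|p n| <= B) ->
  `|latch B r p n| <= B.
Proof.
move=> B0 rE pB; elim: n => [|n IH] /=; first by rewrite normr0.
by rewrite rE latch_stepE //; case: ifP.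
Qed.

Lemma latch_run (R : realType) (B : R) (r p : nat -> R) (b : nat -> bool)
    (n k : nat) : 0 <= B ->
  (forall n, r n = (b n)%:R) -> (forall n, `|p n| <= B) ->
  b n -> (forall i, (i < k)%N -> ~~ b (n.+1 + i)%N) ->
  latch B r p (n.+1 + k) = p n.
Proof.
move=> B0 rE pB bn; elim: k => [_|k IH bk].
  by rewrite addn0 /= rE latch_stepE ?bn //; apply: latch_bound.
rewrite addnS latchS rE latch_stepE ?(negbTE (bk k _)) //;
  last exact: latch_bound.
by apply: IH => i lt_ik; apply: bk; lia.
Qed.

Lemma latch_idle (R : realType) (B : R) (r p : nat -> R) (b : nat -> bool)
    (n : nat) : 0 <= B ->
  (forall n, r n = (b n)%:R) -> (forall n, `|p n| <= B) ->
  (forall i, (i < n)%N -> ~~ b i) -> latch B r p n = 0.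
Proof.
move=> B0 rE pB; elim: n => // n IH bn.
rewrite /= rE (negbTE (bn n _)) // latch_stepE //; last exact: latch_bound.
by apply: IH => i lt_in; apply: bn; lia.
Qed.

(** * Realizability and error bounds *)

Ltac solve_affine := repeat first
  [ assumption | exact: is_affine_const | exact: is_affine_var
  | exact: is_affine_input | apply: is_affineD | apply: is_affineN
  | apply: is_affineZ ].

Ltac solve_relu_net := repeat first
  [ by apply: is_relu_net_affine; solve_affine
  | by apply: is_relu_net_relu; solve_affine
  | apply: is_relu_netD | apply: is_relu_netN | apply: is_relu_netZ ].

Definition comp4 (R : realType) (c : R * R * R * R) (j : 'I_4) : R :=
  match val j with
  | 0%N => c.1.1.1 | 1%N => c.1.1.2 | 2%N => c.1.2 | _ => c.2
  end.

Definition comp3 (R : realType) (c : R * R * R) (j : 'I_3) : R :=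
  match val j with 0%N => c.1.1 | 1%N => c.1.2 | _ => c.2 end.

Lemma realizable_pulse (R : realType) (I : finType) (y : I -> R -> nat -> R)
    (A : nat) : realizable y ->
  realizable (sum_fam y (fun (_ : unit) _ n => pulse R A n)).
Proof.
move=> ry.
pose o k (lt_k : (k < 4)%N) := Ordinal lt_k.
pose G (j : 'I_4) (z : I + 'I_4 -> R) (u : R) := comp4 (clock_step A
  (z (inr (o 0%N isT)), z (inr (o 1%N isT)), z (inr (o 2%N isT)),
   z (inr (o 3%N isT)))) j.
have rs : realizable (sum_fam y (fun j _ n => comp4 (clock R A n) j)).
  apply: (@realizable_ext _ _ _ _ _ (comp4 (clock R A 0)) G) => //.
    case=> [[|[|[|[|//]]]] lt_j]; rewrite /G /comp4 /=; solve_relu_net.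
  move=> j x n; rewrite /G /sum_fam clockS.
  by case: (clock R A n) => [[[u v] m] r].
pose g (k : I + unit) (z : I + 'I_4 -> R) (_ : R) :=
  match k with inl i => z (inl i) | inr _ => z (inr (o 3%N isT)) end.
apply: (@realizable_affine _ _ _ _ _ _ id g rs).
  by case=> [i|[]]; rewrite /g; exact: is_affine_var.
by case.
Qed.

(** A whole layer of squarers at once, driven by the common pulse [y i0]. *)
Lemma realizable_squarer (R : realType) (I K : finType)
    (y : I -> R -> nat -> R) (i0 : I) (g : K -> (I -> R) -> R -> R) :
  realizable y -> (forall k, is_affine (g k)) ->
  realizable (fun k x n =>
    (squarer (y i0 x) (fun m => g k (fun i => y i x m) 0) n).2).
Proof.
move=> ry hg.
pose o k (lt_k : (k < 3)%N) := Ordinal lt_k.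
pose G (kj : K * 'I_3) (z : I + (K * 'I_3) -> R) (u : R) :=
  comp3 (squarer_step (z (inl i0)) (g kj.1 (fun i => z (inl i)) 0)
    (z (inr (kj.1, o 0%N isT)), z (inr (kj.1, o 1%N isT)),
     z (inr (kj.1, o 2%N isT)))) kj.2.
pose s (kj : K * 'I_3) x n :=
  comp3 (squarer (y i0 x) (fun m => g kj.1 (fun i => y i x m) 0) n) kj.2.
have rs : realizable (sum_fam y s).
  apply: (@realizable_ext _ _ _ _ _ (fun kj => comp3 (0, 1, 0) kj.2) G) => //.
    move=> [k j]; rewrite /G /=.
    have h : is_affine
        (fun (z : I + (K * 'I_3) -> R) (_ : R) => g k (fun i => z (inl i)) 0).
      apply: (@is_affine_comp _ _ _ (fun z _ => g k z 0)).
        exact: is_affine_input0.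
      by move=> i; exact: is_affine_var.
    by case: j => [[|[|[|//]]] lt_j]; rewrite /comp3 /=; solve_relu_net.
  move=> [k j] x n; rewrite /G /s /=.
  by case: (squarer _ _ n) => [[s' M] q].
pose g' (k : K) (z : I + (K * 'I_3) -> R) (_ : R) := z (inr (k, o 2%N isT)).
apply: (@realizable_affine _ _ _ _ _ _ id g' rs) => //.
by move=> k; exact: is_affine_var.
Qed.

Lemma realizable_latch (R : realType) (I : finType)
    (y : I -> R -> nat -> R) (i0 : I) (B : R) (g : (I -> R) -> R -> R) :
  realizable y -> is_affine g ->
  realizable (fun (_ : unit) x n =>
    latch B (y i0 x) (fun m => g (fun i => y i x m) 0) n).
Proof.
move=> ry hg.
pose G (_ : unit) (z : I + unit -> R) (_ : R) :=
  latch_step B (z (inl i0)) (g (fun i => z (inl i)) 0) (z (inr tt)).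
pose s (_ : unit) x n := latch B (y i0 x) (fun m => g (fun i => y i x m) 0) n.
have rs : realizable (sum_fam y s).
  apply: (@realizable_ext _ _ _ _ _ (fun=> 0) G) => // j.
  have h : is_affine
      (fun (z : I + unit -> R) (_ : R) => g (fun i => z (inl i)) 0).
    apply: (@is_affine_comp _ _ _ (fun z _ => g z 0)).
      exact: is_affine_input0.
    by move=> i; exact: is_affine_var.
  by rewrite /G /latch_step; solve_relu_net.
pose g' (_ : unit) (z : I + unit -> R) (_ : R) := z (inr tt).
apply: (@realizable_affine _ _ _ _ _ _ id g' rs) => //.
by move=> k; exact: is_affine_var.
Qed.

(** * Approximate powers, layer by layer *)

Definition held (R : realType) (x : R) (n : nat) : R :=
  if n == 0%N then 0 else x.

Lemma realizable_held (R : realType) :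
  realizable (fun (_ : unit) (x : R) n => held x n).
Proof.
exists unit, (fun=> 0), (fun v z u => z v + u), (fun x n _ => held x n).
split=> //.
- by move=> v; apply: is_relu_net_affine; solve_affine.
- by move=> x [|n] _; rewrite /held /impulse_at /= ?add0r ?addr0.
- by move=> v; exists (fun z _ => z tt) => //; exact: is_affine_var.
Qed.

(** Entry j of layer l aims at (x / D)^j when j <= 2^l; the remaining entries are bounded fillers.
    The exponent splits as [uphalf j] plus [j./2], and dividing by D keeps the operands in
    [-1, 1]. *)
Fixpoint power_approx (R : realType) (D : R) (N l : nat) (x : R) (n : nat)
    (j : 'I_N.+1) : R :=
  if l is l'.+1 then
    let y m := power_approx D l' x m (inord (uphalf j) : 'I_N.+1) in
    let y' m := power_approx D l' x m (inord j./2 : 'I_N.+1) in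
    multiplier (pulse R l) y y' n
  else if j == 0%N :> nat then 1 else if j == 1%N :> nat then D^-1 * held x n
  else 0.

Lemma realizable_power_approx (R : realType) (D : R) (N l : nat) :
  realizable (fun j x n => @power_approx R D N l x n j).
Proof.
elim: l => [|l IH].
  pose g (j : 'I_N.+1) (z : unit -> R) (_ : R) : R :=
    if j == 0%N :> nat then 1 else if j == 1%N :> nat then D^-1 * z tt else 0.
  apply: (@realizable_affine _ _ _ _ _ _ id g (@realizable_held R)) => // j.
  by rewrite /g; case: eqP => _; last case: eqP => _; solve_affine.
have rp := realizable_pulse l.+1 IH.
(* The boolean selects one of the two squarers of the polarization. *)
pose sgn (b : bool) : R := if b then 1 else -1.
pose g (k : 'I_N.+1 * bool) (z : 'I_N.+1 + unit -> R) (_ : R) := 2^-1 *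
  (z (inl (inord (uphalf k.1))) + sgn k.2 * z (inl (inord (k.1)./2))).
have hg k : is_affine (g k) by rewrite /g; solve_affine.
have rs := realizable_squarer (inr tt) rp hg.
pose g' (j : 'I_N.+1) (z : 'I_N.+1 * bool -> R) (_ : R) :=
  z (j, true) - z (j, false).
apply: (@realizable_affine _ _ _ _ _ _ id g' rs) => [j|j x n].
  by rewrite /g'; solve_affine.
rewrite /g' /g /sgn /= /multiplier.
by congr (_ - _); congr ((@squarer R _ _ n).2); apply/funext => m;
  rewrite ?mul1r ?mulN1r.
Qed.

Lemma power_approx_bound (R : realType) (D : R) (N l : nat) (x : R) (n : nat)
    (j : 'I_N.+1) : 0 < D -> `|x| <= D -> `|power_approx D l x n j| <= 1.
Proof.
move=> D0 xD; elim: l n j => [|l IH] n j /=.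
  case: eqP => _; first by rewrite normr1.
  case: eqP => _; last by rewrite normr0.
  rewrite /held; case: eqP => _; first by rewrite mulr0 normr0.
  by rewrite normrM gtr0_norm ?invr_gt0 // ler_pdivrMl // mulr1.
by apply: (@multiplier_bound _ _ _ _ (pulse_time l.+1)) => m;
  rewrite ?pulseE.
Qed.

(** As all factors are bounded by 1, the error satisfies E(l+1) <= 2 E(l) + 4^-(2^k) with E(0) =
    0. *)
Lemma power_approx_err (R : realType) (D : R) (N l k : nat) (x : R)
    (j : 'I_N.+1) : 0 < D -> `|x| <= D -> (j <= 2 ^ l)%N ->
  `|power_approx D l x (2 ^ k * l.+1) j - (x / D) ^+ j|
  <= (2 ^+ l - 1) * 4^-1 ^+ (2 ^ k).
Proof.
move=> D0 xD; elim: l j => [|l IH] j le_j.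
  (* The time 2^k is positive, so [held] already equals x and layer 0 is exact. *)
  rewrite /= expr0 subrr mul0r /held muln1 expn_eq0 /=.
  have := le_j; rewrite expn0; case: eqP => [->|j0] j1.
    by rewrite expr0 subrr normr0.
  have -> : j = 1%N :> nat by lia.
  by rewrite expr1 mulrC subrr normr0.
have xD1 : `|x / D| <= 1.
  by rewrite normrM (@gtr0_norm _ D^-1) ?invr_gt0 // ler_pdivrMr // mul1r.
have e_gt0 : (0 < 2 ^ k)%N by rewrite expn_gt0.
have le_jN : (j <= N)%N by rewrite -ltnS.
have juE : (inord (uphalf j) : 'I_N.+1) = uphalf j :> nat
  by rewrite inordK; lia.
have jdE : (inord j./2 : 'I_N.+1) = j./2 :> nat by rewrite inordK; lia.
rewrite expnS in le_j.
have := IH (inord (uphalf j)); have := IH (inord j./2).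
rewrite juE jdE => /(_ ltac:(lia)) errd /(_ ltac:(lia)) erru.
(* Of the 2^k steps, the first loads the operands and the others iterate. *)
have nE : (2 ^ k * l.+2 = (2 ^ k * l.+1).+1 + (2 ^ k).-1)%N.
  by rewrite !mulnS; lia.
have run := @multiplier_run R (pulse R l.+1)
  (fun m => power_approx D l x m (inord (uphalf j) : 'I_N.+1))
  (fun m => power_approx D l x m (inord j./2 : 'I_N.+1))
  (pulse_time l.+1) (2 ^ k * l.+1) (2 ^ k).-1
  (fun n => pulseE _ n (ltn0Sn l))
  (fun m => power_approx_bound l m _ D0 xD)
  (fun m => power_approx_bound l m _ D0 xD) (pulse_time_exp _ _).
have {run} : `|power_approx D l.+1 x (2 ^ k * l.+2) j
    - power_approx D l x (2 ^ k * l.+1) (inord (uphalf j) : 'I_N.+1)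
      * power_approx D l x (2 ^ k * l.+1) (inord j./2 : 'I_N.+1)|
    <= 4^-1 ^+ (2 ^ k).
  rewrite nE -[X in _ ^+ X]prednK //; apply: run => i lt_i.
  (* The next reload comes at 2^(k+1) (l+1) >= 2^k (l+2). For l = 0 it falls on the reading time
     itself and takes effect one step later. *)
  apply: (@pulse_time_between _ k); first by lia.
  by rewrite expnS; have := leq_pmulr (2 ^ k) (ltn0Sn l); lia.
have b1 := power_approx_bound l (2 ^ k * l.+1) (inord j./2 : 'I_N.+1) D0 xD.
have u1 : `|(x / D) ^+ uphalf j| <= 1 by rewrite normrX exprn_ile1.
have -> : (x / D) ^+ j = (x / D) ^+ uphalf j * (x / D) ^+ j./2.
  by rewrite -exprD uphalf_half -addnA addnn odd_double_half.
move: b1 u1 errd erru; rewrite exprS.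
move: (power_approx _ l.+1 _ _ _) (power_approx _ _ _ _ (inord (uphalf j)))
  (power_approx _ _ _ _ _) (_ ^+ uphalf j) (_ ^+ j./2) => Y a b U V.
set e := (_ - 1) * _ => b1 u1 errd erru errY.
have -> : Y - U * V = (Y - a * b) + ((a - U) * b + U * (b - V)) by ring.
apply: le_trans (ler_normD _ _) _.
have := ler_normD ((a - U) * b) (U * (b - V)); rewrite !normrM.
have e1 : `|a - U| * `|b| <= e by rewrite -[e]mulr1 ler_pM.
have e2 : `|U| * `|b - V| <= e by rewrite -[e]mul1r ler_pM.
by rewrite /e in e1 e2 *; lra.
Qed.

(** * The polynomial and its latched value *)

Lemma weighted_sum_bound (R : realType) (N : nat) (a c : 'I_N.+1 -> R)
    (D eps : R) : 1 <= D -> (forall i, `|c i| <= eps) ->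
  `|\sum_(i < N.+1) a i * D ^+ i * c i| <= norm1 a * D ^+ N * eps.
Proof.
move=> D1 ceps; apply: le_trans (ler_norm_sum _ _ _) _.
rewrite /norm1 !mulr_suml; apply: ler_sum => i _; rewrite !normrM.
apply: ler_pM; rewrite ?mulr_ge0 //.
apply: ler_wpM2l => //; rewrite ger0_norm; last by apply: exprn_ge0; lra.
by rewrite ler_weXn2l // -ltnS.
Qed.

Definition poly_approx (R : realType) (N l : nat) (a : 'I_N.+1 -> R) (D x : R)
    (n : nat) : R :=
  \sum_(i < N.+1) a i * D ^+ i * power_approx D l x n i.

(** This clock pulses at the times 2^k (l+1), where [power_approx_err] controls layer l; the latch
    bound is that of [poly_approx_bound]. *)
Definition poly_latched (R : realType) (N l : nat) (a : 'I_N.+1 -> R)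
    (D x : R) : nat -> R :=
  latch (norm1 a * D ^+ N) (pulse R l.+1) (poly_approx l a D x).

Lemma realizable_poly_latched (R : realType) (N l : nat) (a : 'I_N.+1 -> R)
    (D : R) : realizable (fun (_ : unit) => poly_latched l a D).
Proof.
have rp := realizable_pulse l.+1 (@realizable_power_approx R D N l).
pose g (z : 'I_N.+1 + unit -> R) (_ : R) :=
  \sum_(i < N.+1) a i * D ^+ i * z (inl i).
apply: (realizable_latch (inr tt) (norm1 a * D ^+ N) (g := g) rp).
by apply: is_affine_sum => i; solve_affine.
Qed.

Lemma poly_approx_bound (R : realType) (N l : nat) (a : 'I_N.+1 -> R)
    (D x : R) (n : nat) : 1 <= D -> `|x| <= D ->
  `|poly_approx l a D x n| <= norm1 a * D ^+ N.
Proof.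
move=> D1 xD; rewrite -[leRHS]mulr1; apply: weighted_sum_bound => // i.
by apply: power_approx_bound => //; lra.
Qed.

Lemma poly_rescale (R : realType) (N : nat) (a : 'I_N.+1 -> R) (D x : R) :
  0 < D ->
  \sum_(i < N.+1) a i * x ^+ i = \sum_(i < N.+1) a i * D ^+ i * (x / D) ^+ i.
Proof.
move=> D0; apply: eq_bigr => i _.
by rewrite -mulrA -exprMn [D * _]mulrC divfK ?gt_eqF.
Qed.

Lemma poly_approx_err (R : realType) (N l k : nat) (a : 'I_N.+1 -> R)
    (D x : R) : 1 <= D -> `|x| <= D -> (N <= 2 ^ l)%N ->
  `|poly_approx l a D x (2 ^ k * l.+1) - \sum_(i < N.+1) a i * x ^+ i|
  <= norm1 a * D ^+ N * ((2 ^+ l - 1) * 4^-1 ^+ (2 ^ k)).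
Proof.
move=> D1 xD leN; rewrite (@poly_rescale _ _ _ D); last lra.
rewrite /poly_approx -sumrB; under eq_bigr do rewrite -mulrBr.
apply: weighted_sum_bound => // i; apply: power_approx_err => //; first lra.
by apply: leq_trans leN; rewrite -ltnS.
Qed.

(** The windows are open on the left and closed on the right because a latch shows a sample one step
    after the pulse. *)
Lemma dyadic_window (A n : nat) : (0 < A)%N -> (n <= A)%N \/
  exists k, (2 ^ k * A < n)%N /\ (n <= 2 ^ k.+1 * A)%N.
Proof.
move=> A_gt0; elim: n => [|n [le_n|[k [lt_n le_n]]]]; first by left.
  case: (ltnP n A) => [|ge_n]; first by left.
  by right; exists 0%N; rewrite expn0 expn1; lia.
right; case: (ltnP n (2 ^ k.+1 * A)) => [lt_n'|ge_n]; first by exists k; lia.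
by exists k.+1; rewrite (expnS 2 k.+1); nia.
Qed.

Lemma poly_latched_err (R : realType) (N l n : nat) (a : 'I_N.+1 -> R)
    (D x : R) : 1 <= D -> `|x| <= D -> (N <= 2 ^ l)%N ->
  let err := `|poly_latched l a D x n - \sum_(i < N.+1) a i * x ^+ i| in
  (n <= l.+1)%N /\ err <= norm1 a * D ^+ N \/
  exists k, (n <= 2 ^ k.+1 * l.+1)%N /\
    err <= norm1 a * D ^+ N * ((2 ^+ l - 1) * 4^-1 ^+ (2 ^ k)).
Proof.
move=> D1 xD leN err.
have B0 : 0 <= norm1 a * D ^+ N.
  by rewrite mulr_ge0 ?sumr_ge0 ?exprn_ge0 //; lra.
have pB m : `|poly_approx l a D x m| <= norm1 a * D ^+ N.
  exact: poly_approx_bound.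
have rE m : pulse R l.+1 m = (pulse_time l.+1 m)%:R by exact: pulseE.
case: (dyadic_window n (ltn0Sn l)) => [le_n|[k [lt_n le_n]]].
  (* Up to the first pulse the latch shows 0, so the error is the size of the polynomial itself. *)
  left; split=> //; rewrite /err /poly_latched (latch_idle B0 rE pB).
    rewrite sub0r normrN (@poly_rescale _ _ _ D); last lra.
    rewrite -[leRHS]mulr1; apply: weighted_sum_bound => // i.
    rewrite normrX exprn_ile1 // normrM (@gtr0_norm _ D^-1) ?invr_gt0; try lra.
    by rewrite ler_pdivrMr ?mul1r //; lra.
  by move=> i lt_i; apply: pulse_time_before; lia.
right; exists k; split=> //; rewrite /err /poly_latched.
rewrite (_ : n = (2 ^ k * l.+1).+1 + (n - (2 ^ k * l.+1).+1))%N; last by lia.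
rewrite (latch_run B0 rE pB); first exact: poly_approx_err.
  exact: pulse_time_exp.
by move=> i lt_i; apply: (@pulse_time_between _ k); lia.
Qed.

(** * The number of layers and the decay rate *)

Lemma ceil_log2 (R : realType) (N : nat) : (1 < N)%N -> exists l : nat,
  [/\ Num.ceil (log2 (N%:R : R)) = l%:Z, (0 < l)%N, (N <= 2 ^ l)%N &
      (2 ^ l <= 2 * N)%N].
Proof.
move=> N_gt1; have ln2 : 0 < ln (2 : R) by rewrite ln_gt0 // ltr1n.
have N_gt0 : (0 < N)%N by lia.
have log_gt0 : 0 < log2 (N%:R : R).
  by rewrite /log2 divr_gt0 // ln_gt0 // ltr1n.
have expE (m : nat) : ln ((2 ^ m)%:R : R) = m%:R * ln 2.
  by rewrite natrX lnXn // mulr_natl.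
have : 0 < Num.ceil (log2 (N%:R : R)) by rewrite ceil_gt0.
case lE : (Num.ceil (log2 (N%:R : R))) => [l|l] // l_gt0.
exists l; split=> //.
  have := ceil_ge (log2 (N%:R : R)); rewrite lE /log2 ler_pdivrMr // => hl.
  have : ln (N%:R : R) <= ln (2 ^ l)%:R by rewrite expE.
  by rewrite ler_ln ?posrE ?ltr0n ?expn_gt0 // ler_nat.
(* Minimality of the ceiling gives 2^(l-1) < N, which will bound the error factor 2^l - 1 by 2 N. *)
have := ceilB1_lt (log2 (N%:R : R)); rewrite lE /log2 ltr_pdivlMr //.
case: l {lE} l_gt0 => // l _.
rewrite (_ : _%:~R = l%:R); last by rewrite intS addrAC subrr add0r.
move=> hl; have : ln (2 ^ l)%:R < ln (N%:R : R) by rewrite expE.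
by rewrite ltr_ln ?posrE ?ltr0n ?expn_gt0 // ltr_nat expnS leq_pmul2l //
  => /ltnW.
Qed.

Lemma decayE (R : realType) (N t l : nat) : (1 < N)%N ->
  Num.ceil (log2 (N%:R : R)) = l%:Z ->
  decay R N t = 4 `^ (- (t%:R / (4 * l%:R))).
Proof.
by move=> N_gt1 lE; rewrite /decay /C2 lE gtn_eqF // mulrC.
Qed.

Lemma le_decay (R : realType) (N t l m : nat) : (1 < N)%N -> (0 < l)%N ->
  Num.ceil (log2 (N%:R : R)) = l%:Z -> (t <= m * (4 * l))%N ->
  4^-1 ^+ m <= decay R N t.
Proof.
move=> N_gt1 l_gt0 lE le_t; rewrite (decayE t N_gt1 lE).
rewrite exprVn -powR_mulrn ?ler0n // -powRN ler_powR ?ler1n //.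
rewrite lerN2 ler_pdivrMr; last by rewrite mulr_gt0 ?ltr0n.
by rewrite -!natrM ler_nat.
Qed.

Unset Implicit Arguments.

Theorem mainTheorem1 (R : realType) (N : nat) (a : 'I_N.+1 -> R) (D : R)
    (hN : (0 < N)%N) (hD : 1 <= D) :
  exists m : nat, (0 < m)%N /\
  exists Ra : rnn R 1 1 m,
  forall t : nat, 16 * log2 (N%:R : R) <= t%:R ->
    (ereal_sup [set (`| rnn_op Ra (impulse (const_mx x)) t ord0 ord0
                        - \sum_(i < N.+1) a i * x ^+ i |)%:E
               | x in [set` `[- D, D]%R]]
     <= (norm1 a * C1 N D * decay R N t)%:E)%E.
Proof.
have a_ge0 : 0 <= norm1 a by apply: sumr_ge0.
have [N1|N_gt1] : N = 1%N \/ (1 < N)%N by lia.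
  (* For N = 1 the bound is 0, so the network must be exact: it holds x and outputs a_0 + a_1 x. *)
  subst N.
  pose g (_ : unit) (z : unit -> R) (_ : R) := a ord0 + a ord_max * z tt.
  have [|m [m_gt0 [W WE]]] := @realizable_rnn R unit
      (fun _ x n => g tt (fun _ => held x n) 0) tt.
    apply: (@realizable_affine _ _ _ _ _ _ id g (@realizable_held R)) => // j.
    by rewrite /g; solve_affine.
  exists m; split=> //; exists W => t _.
  rewrite /decay mulr0; apply: ge_ereal_sup => _ [x _ <-].
  rewrite WE /g /held /= !big_ord_recl big_ord0 addr0 expr0 mulr1 expr1.
  rewrite (_ : lift ord0 ord0 = ord_max); last exact/val_inj.
  by rewrite subrr normr0.
have [l [lE l_gt0 leN geN]] := ceil_log2 R N_gt1.
have [m [m_gt0 [W WE]]] :=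
  realizable_rnn tt (realizable_poly_latched l a D).
exists m; split=> //; exists W => t _.
apply: ge_ereal_sup => _ [x /= xD <-]; rewrite WE lee_fin.
have {}xD : `|x| <= D by move: xD; rewrite in_itv /= ler_norml.
have D0 : 0 <= D by lra.
have DN0 : 0 <= D ^+ N by exact: exprn_ge0.
have D2N : D ^+ N <= D ^+ (2 * N) by apply: ler_weXn2l => //; lia.
have N1R : 1 <= N%:R :> R by rewrite ler1n.
have lN : 2 ^+ l <= 2 * N%:R :> R by rewrite -natrX -natrM ler_nat.
have q0 : 0 <= 4^-1 :> R by lra.
(* To be used with c = 4 up to the first pulse and with c = 2^l - 1 afterwards. *)
have C1E c : 0 <= c -> c <= 16 * N%:R ->
    norm1 a * D ^+ N * c <= norm1 a * C1 N D.
  move=> c0 cN; rewrite -mulrA ler_wpM2l // /C1 mulrC.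
  by apply: ler_pM.
(* The output at time t is read from the machine state t + 1. *)
case: (poly_latched_err t.+1 a hD xD leN) => [[le_t le_err]|[k [le_t le_err]]].
  apply: (le_trans le_err).
  (* Here t <= l, so the decay factor is still at least 1/4; the constant absorbs the factor 4. *)
  have dE : 4^-1 ^+ 1 <= decay R N t by apply: (le_decay N_gt1 l_gt0 lE); lia.
  apply: (@le_trans _ _ (norm1 a * D ^+ N * 4 * 4^-1 ^+ 1)).
    by rewrite expr1 mulfK.
  apply: ler_pM; rewrite ?mulr_ge0 ?exprn_ge0 //.
  by apply: C1E; lra.
apply: (le_trans le_err); rewrite mulrA; apply: ler_pM.
- by rewrite !mulr_ge0 // subr_ge0 exprn_ege1 // ler1n.
- exact: exprn_ge0.
- by apply: C1E; [rewrite subr_ge0 exprn_ege1 // ler1n|lra].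
- apply: (le_decay N_gt1 l_gt0 lE).
  (* Since l >= 1, l + 1 <= 2 l; this is where the 4 in the denominator of [C2] comes from. *)
  have : (2 ^ k.+1 * l.+1 <= 2 ^ k * (4 * l))%N.
    by rewrite expnS mulnC mulnA [X in (_ <= X)%N]mulnC leq_pmul2r
      ?expn_gt0; lia.
  lia.
Qed.
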